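(* Let $V$ be a vertex algebra over $\mathbb{C}$ and let $U$ be a subspace that generates $V$ as a vertex algebra. Suppose that there exists a vector space decomposition $U=\coprod_{n\ge1}U_n$ such that for any $m,n\ge1$, $u\in U_m$, $v\in U_n$, $i\ge0$, the vector $u_iv$ is a linear combination of vectors $$u^{(1)}_{-n_1}\cdots u^{(r)}_{-n_r}\mathbf{1}$$ with $r\ge0$, $u^{(i)}\in U_{m_i}$, $n_i\ge1$ and $m_1+\cdots+m_r\le m+n-1$. Then $U$ generates $V$ with PBW spanning property.
   Context: Vertex algebra: a vector space $V$ over $\mathbb{C}$ with a linear map $Y:V\to\mathrm{Hom}(V,V((x)))$, $v\mapsto Y(v,x)=\sum_{n\in\mathbb{Z}}v_nx^{-n-1}$ ($v_n\in\mathrm{End}\,V$), and a vector $\mathbf{1}\in V$ such that $Y(\mathbf{1},x)=\mathrm{id}$; $Y(v,x)\mathbf{1}\in V[[x]]$ with $v_{-1}\mathbf{1}=v$ for $v\in V$; and for $u,v\in V$ the Jacobi identity holds: $$x_0^{-1}\delta\left(\tfrac{x_1-x_2}{x_0}\right)Y(u,x_1)Y(v,x_2)-x_0^{-1}\delta\left(\tfrac{x_2-x_1}{-x_0}\right)Y(v,x_2)Y(u,x_1)=x_2^{-1}\delta\left(\tfrac{x_1-x_0}{x_2}\right)Y(Y(u,x_0)v,x_2),$$ where $\delta(x)=\sum_{n\in\mathbb{Z}}x^n$ and powers of binomials are expanded in nonnegative powers of the second variable. $U$ generates $V$ as a vertex algebra if $V=\mathrm{span}\{u^{(1)}_{n_1}\cdots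 u^{(r)}_{n_r}\mathbf{1}\mid r\ge0,u^{(i)}\in U,n_i\in\mathbb{Z}\}$. $U$ generates $V$ with PBW spanning property if for some basis $\{u^{(\alpha)}\mid\alpha\in I\}$ of $U$ and for any (total) order ``$>$'' on the set $\{u^{(\alpha)}_{-r}\mid\alpha\in I,\ r\ge1\}$, $V$ is linearly spanned by the vectors $u^{(\alpha_1)}_{-n_1}\cdots u^{(\alpha_r)}_{-n_r}\mathbf{1}$ with $r\ge0$, $\alpha_i\in I$, $n_i\ge1$ and $u^{(\alpha_1)}_{-n_1}\ge\cdots\ge u^{(\alpha_r)}_{-n_r}$. *)

(* Defs.v *)
From HB Require Import structures.
From mathcomp Require Import all_boot all_order all_algebra.
From mathcomp Require Import boolp classical_sets functions cardinality fsbigop.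

Set Implicit Arguments.
Unset Strict Implicit.
Unset Printing Implicit Defensive.

Import Order.TTheory GRing.Theory Num.Theory.

Local Open Scope classical_set_scope.
Local Open Scope ring_scope.

Section FormalSeries.
Variable C : numFieldType.

(* n (n - 1) ... (n - i + 1) / i!, for n a possibly negative integer *)
Definition binomz (n : int) (i : nat) : C :=
  (\prod_(j < i) (n - j%:Z)%:~R) / (i`!)%:R.

(* coefficient of x^b y^c in (x - y)^n, expanded in nonnegative powers of y *)
Definition binom_coef (n b c : int) : C :=
  if (0 <= c) && (b + c == n) then (-1) ^ c * binomz n `|c|%N else 0.

(* coefficient of z^a x^b y^c in
     z^-1 delta((x - y) / (e z)) = \sum_(n in Z) e^-n z^(- n - 1) (x - y)^n
   only n = - a - 1 contributes *)
Definition delta_coef (e : C) (a b c : int) : C :=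
  e ^ (a + 1) * binom_coef (- a - 1) b c.

(* A formal series in x0, x1, x2 is the family of its coefficients, f a b c
   being that of x0^a x1^b x2^c. The sum below is over the finite support of
   the summand; it is finite for the three products in the Jacobi identity, by
   the truncation axiom and because delta_coef has no negative power of its
   last variable. *)
Definition mul_series (V : lmodType C) (d : int -> int -> int -> C)
    (f : int -> int -> int -> V) (a b c : int) : V :=
  \sum_(p \in [set: int * int * int])
    d p.1.1 p.1.2 p.2 *: f (a - p.1.1) (b - p.1.2) (c - p.2).

End FormalSeries.

(* mode v n is v_n, so the coefficient of x^k in Y(v, x) w is
   mode v (- k - 1) w *)
Record vertexAlgebra (C : numFieldType) := VertexAlgebra {
  va_sort :> lmodType C ;
  mode : va_sort -> int -> va_sort -> va_sort ;
  vac : va_sort ;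
  mode_linear_state : forall (n : int) (w : va_sort),
    linear (fun v => mode v n w) ;
  mode_linear_end : forall (v : va_sort) (n : int), linear (mode v n) ;
  mode_truncation : forall v w : va_sort,
    exists N : int, forall n : int, N <= n -> mode v n w = 0 ;
  mode_vac : forall (n : int) (w : va_sort),
    mode vac n w = if n == -1 then w else 0 ;
  mode_creation : forall (v : va_sort) (n : int), 0 <= n -> mode v n vac = 0 ;
  mode_creationN1 : forall v : va_sort, mode v (-1) vac = v ;
  jacobi_identity : forall (u v w : va_sort) (a b c : int),
    mul_series (fun a b c => delta_coef 1 a b c)
      (fun a b c => (* Y(u,x1) Y(v,x2) w *)
         if a == 0 then mode u (- b - 1) (mode v (- c - 1) w) else 0) a b c
    - mul_series (fun a b c => delta_coef (-1) a c b)
      (fun a b c => (* Y(v,x2) Y(u,x1) w *)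
         if a == 0 then mode v (- c - 1) (mode u (- b - 1) w) else 0) a b c
    = mul_series (fun a b c => delta_coef 1 c b a)
      (fun a b c => (* Y(Y(u,x0)v,x2) w *)
         if b == 0 then mode (mode u (- a - 1) v) (- c - 1) w else 0) a b c
}.

Arguments mode {C V} v n w : rename.
Arguments vac {C V} : rename.

Section LinearAlgebra.
Variables (C : numFieldType) (V : lmodType C).

Definition subspace (U : set V) : Prop := GRing.submod_closed [in U].

Definition lin_span (S : set V) : set V :=
  [set v | exists (k : nat) (c : 'I_k -> C) (s : 'I_k -> V),
      (forall i, S (s i)) /\ v = \sum_(i < k) c i *: s i].

Definition is_basis (I : Type) (b : I -> V) (U : set V) : Prop :=
  [/\ forall i, U (b i),
      forall (k : nat) (f : 'I_k -> I) (c : 'I_k -> C), injective f ->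
        \sum_(j < k) c j *: b (f j) = 0 -> forall j, c j = 0
    & U `<=` lin_span (range b)].

(* U is the internal direct sum of the subspaces Un 1, Un 2, ...; the value of
   Un at 0 is ignored *)
Definition is_direct_sum (U : set V) (Un : nat -> set V) : Prop :=
  [/\ forall n, (1 <= n)%N -> subspace (Un n),
      forall u, U u <-> exists (N : nat) (f : nat -> V),
        (forall n, (1 <= n)%N -> Un n (f n)) /\ u = \sum_(1 <= n < N) f n
    & forall (N : nat) (f : nat -> V),
        (forall n, (1 <= n)%N -> Un n (f n)) -> \sum_(1 <= n < N) f n = 0 ->
        forall n, (1 <= n < N)%N -> f n = 0].

End LinearAlgebra.

Section Generation.
Variables (C : numFieldType) (V : vertexAlgebra C).

(* apply_ops [:: T1; ...; Tr] is T1 (... (Tr vac)) *)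
Definition apply_ops (s : seq (V -> V)) : V := foldr (fun T x => T x) vac s.

Definition generates (U : set V) : Prop :=
  lin_span [set x | exists s : seq (V * int),
      all (fun p => p.1 \in U) s /\
      x = apply_ops [seq mode p.1 p.2 | p <- s]] = [set: V].

(* The total orders range over the relations on the set of operators
   u^(alpha)_{-r}; only the values of ge on this set matter. *)
Definition PBW_spanning (U : set V) : Prop :=
  exists (I : Type) (u : I -> V), is_basis u U /\
    let op (p : I * nat) : V -> V := mode (u p.1) (- p.2%:Z) in
    let ops : set (V -> V) := [set op p | p in [set p | (1 <= p.2)%N]] in
    forall ge : rel (V -> V),
      {in ops, reflexive ge} -> {in ops &, antisymmetric ge} ->
      {in ops & &, transitive ge} -> {in ops &, total ge} ->
      lin_span [set x | exists s : seq (I * nat),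
          [/\ all (fun p => (1 <= p.2)%N) s, sorted ge [seq op p | p <- s]
            & x = apply_ops [seq op p | p <- s]]] = [set: V].

(* the vectors u^(1)_{-n_1} ... u^(r)_{-n_r} vac with u^(i) \in Un m_i, n_i >= 1
   and m_1 + ... + m_r <= d; an entry of s is (m_i, u^(i), n_i) *)
Definition graded_words (Un : nat -> set V) (d : nat) : set V :=
  [set x | exists s : seq (nat * V * nat),
      [/\ all (fun p => [&& (1 <= p.1.1)%N, p.1.2 \in Un p.1.1
                          & (1 <= p.2)%N]) s,
          (\sum_(p <- s) p.1.1 <= d)%N
        & x = apply_ops [seq mode p.1.2 (- p.2%:Z) | p <- s]]].

End Generation.

(* Main.v *)
(* Let E d be the span of the graded words of degree at most d. The hypothesis
   on u_i v, with the commutator and associativity formulas, makes the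
   filtration E compatible with all modes: x_k y lies in E (a + b) for x in E a,
   y in E b and k an arbitrary integer. As U generates V, the E d exhaust V.
   Moreover [u_{-m}, v_{-n}] is a combination of modes of the vectors u_i v,
   which lie one step lower in the filtration, so reordering a word in a
   homogeneous basis of U changes it only by a vector of lower degree; hence by
   induction on d the sorted words span E d. *)
From HB Require Import structures.
Require Import Defs.
From mathcomp Require Import all_boot all_order all_algebra.
From mathcomp Require Import complex.
From mathcomp Require Import boolp classical_sets reals.
From mathcomp Require Import fsbigop zify.

Set Implicit Arguments.
Unset Strict Implicit.
Unset Printing Implicit Defensive.

Import Order.TTheory GRing.Theory Num.Theory.

Local Open Scope ring_scope.

(** * Subspaces and linear spans *)

Section Subspaces.
Variables (C : numFieldType) (V : lmodType C).
Implicit Types (S P : set V) (x y : V).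

Lemma subspaceI P : P 0 -> (forall a x y, P x -> P y -> P (a *: x + y)) ->
  subspace P.
Proof.
move=> P0 Pl; split=> [|a x y /set_mem Px /set_mem Py]; apply/mem_set => //.
exact: Pl.
Qed.

Section Closure.
Variables (P : set V) (subP : subspace P).

Lemma subspace0 : P 0.
Proof. by apply/set_mem; have [] := subP. Qed.

Lemma subspaceL a x y : P x -> P y -> P (a *: x + y).
Proof. by have [_ Pl] := subP => Px Py; apply/set_mem/Pl; apply/mem_set. Qed.

Lemma subspaceZ a x : P x -> P (a *: x).
Proof. by move=> Px; rewrite -[_ *: _]addr0; apply: subspaceL => //; apply: subspace0. Qed.

Lemma subspaceD x y : P x -> P y -> P (x + y).
Proof. by rewrite -[x in x + y]scale1r; apply: subspaceL. Qed.

Lemma subspaceN x : P x -> P (- x).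
Proof. by rewrite -scaleN1r; apply: subspaceZ. Qed.

Lemma subspaceB x y : P x -> P y -> P (x - y).
Proof. by move=> Px Py; apply/subspaceD/subspaceN. Qed.

Lemma subspace_sum (I : Type) (r : seq I) (p : pred I) (F : I -> V) :
  (forall i, p i -> P (F i)) -> P (\sum_(i <- r | p i) F i).
Proof. by move=> PF; apply: big_ind => //; [apply: subspace0 | apply: subspaceD]. Qed.

Lemma subspace_sum_seq (I : eqType) (r : seq I) (F : I -> V) :
  (forall i, i \in r -> P (F i)) -> P (\sum_(i <- r) F i).
Proof. by rewrite big_seq; apply: subspace_sum. Qed.

Lemma lin_span_sub S : (S `<=` P)%classic -> (lin_span S `<=` P)%classic.
Proof.
move=> SP _ [k [c [s [Ss ->]]]]; apply: subspace_sum => i _.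
exact/subspaceZ/SP.
Qed.

End Closure.

Lemma lin_span_gen S : (S `<=` lin_span S)%classic.
Proof.
move=> x Sx; exists 1%N, (fun=> 1), (fun=> x); split=> //.
by rewrite big_ord1 scale1r.
Qed.

Lemma lin_span_subspace S : subspace (lin_span S).
Proof.
apply: subspaceI => [|a _ _ [k [c [s [Ss ->]]]] [k' [c' [s' [Ss' ->]]]]].
  exists 0%N, (fun=> 0), (fun=> 0); split=> [[]//|].
  by rewrite big_ord0.
exists (k + k')%N,
  (fun i => match split i with inl j => a * c j | inr j => c' j end),
  (fun i => match split i with inl j => s j | inr j => s' j end); split.
  by move=> i; case: split.
rewrite big_split_ord scaler_sumr; congr (_ + _); apply: eq_bigr => i _.
  by rewrite (unsplitK (inl i)) scalerA.
by rewrite (unsplitK (inr i)).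
Qed.

Lemma lin_span_le S S' : (S `<=` S')%classic -> (lin_span S `<=` lin_span S')%classic.
Proof.
move=> SS'; apply: (lin_span_sub (lin_span_subspace S')) => x /SS'.
exact: lin_span_gen.
Qed.

(** Together with [subspace_forall], this lets a predicate with guards and quantifiers serve as a
    subspace in a linear induction. *)
Lemma subspace_imply (A : Prop) P :
  (A -> subspace P) -> subspace [set x | A -> P x]%classic.
Proof.
move=> subP; apply: subspaceI => [/subP/subspace0 //|a x y Px Py HA].
exact: (subspaceL (subP HA)) (Px HA) (Py HA).
Qed.

Lemma subspace_forall (T : Type) (P : T -> set V) :
  (forall t, subspace (P t)) -> subspace [set x | forall t, P t x]%classic.
Proof.
move=> subP; apply: subspaceI => [t|a x y Px Py t]; first exact: subspace0.
exact: subspaceL.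
Qed.

End Subspaces.

Lemma subspace_preim (C : numFieldType) (V W : lmodType C) (P : set V)
    (f : W -> V) : subspace P ->
  linear f -> subspace [set x | P (f x)]%classic.
Proof.
move=> subP fl; pose f' : {linear W -> V} := HB.pack f (GRing.isLinear.Build _ _ _ _ f fl).
apply: subspaceI => [|a x y]; rewrite /= -[f]/(f' : W -> V).
  by rewrite linear0; apply: subspace0.
by rewrite linearP; apply: subspaceL.
Qed.

(** * Commutator and associativity formulas from the Jacobi identity *)

Section Borcherds.
Variables (C : numFieldType) (V : vertexAlgebra C).
Implicit Types (u v w x y : V) (P : set V).

Lemma binomz0 n : binomz C n 0 = 1.
Proof. by rewrite /binomz big_ord0 fact0 divr1. Qed.

Lemma binomz_small (n i : nat) : (n < i)%N -> binomz C n i = 0.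
Proof.
by move=> ni; rewrite /binomz (bigD1 (Ordinal ni)) //= subrr mul0r mul0r.
Qed.

Lemma binom_coef_lt0 n b c : c < 0 -> binom_coef C n b c = 0.
Proof. by move=> c0; rewrite /binom_coef leNgt c0. Qed.

Lemma binom_coef_neq n b c : b + c != n -> binom_coef C n b c = 0.
Proof. by move=> /negbTE bcn; rewrite /binom_coef bcn andbF. Qed.

Lemma binom_coef0 n : binom_coef C n n 0 = 1.
Proof. by rewrite /binom_coef lexx addr0 eqxx binomz0 expr0z mulr1. Qed.

(** The sum runs over a finite support, and is empty by default when the support is infinite, so
    membership is checked term by term. *)
Lemma mul_series_closed P (d : int -> int -> int -> C) f a b c : subspace P ->
  (forall p q r, d p q r != 0 -> P (f (a - p) (b - q) (c - r))) ->
  P (mul_series (V := V) d f a b c).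
Proof.
move=> subP Pf; apply: subspace_sum => // -[[p q] r] _ /=.
have [->|/Pf ?] := eqVneq (d p q r) 0; last exact: subspaceZ.
by rewrite scale0r; apply: subspace0.
Qed.

Lemma mul_series1 (d : int -> int -> int -> C) f a b c (t : int * int * int) :
  (forall p q r, (p, q, r) != t ->
    d p q r *: f (a - p) (b - q) (c - r) = 0) ->
  mul_series (V := V) d f a b c =
  d t.1.1 t.1.2 t.2 *: f (a - t.1.1) (b - t.1.2) (c - t.2).
Proof.
move=> f0; rewrite /mul_series.
rewrite -(@fsbig_widen _ _ _ _ [set t]%classic) ?fsbig_set1 // => -[[p q] r] /= [_ pt].
by apply: f0; apply/eqP => pt'; apply: pt.
Qed.

(** For [0 <= n < c] the falling factorial in [binomz n c] contains the factor 0; outside the stated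
    support the coefficient is 0 by definition. *)
Lemma binom_coef_eq0 (n b c : int) :
  (0 <= c -> b + c = n -> 0 <= n < c) -> binom_coef C n b c = 0.
Proof.
rewrite /binom_coef => nc; case: ifP => // /andP[c0 /eqP bc].
have /andP[n0 ltnc] := nc c0 bc.
case: n c n0 c0 ltnc {nc bc} => [n|//] [c|//] _ _ nc.
by rewrite binomz_small // mulr0.
Qed.

(* The coefficient of x0^-1 in the Jacobi identity. *)
Lemma mode_commutator P u v (m n : int) w : subspace P ->
  (forall p : nat, P (mode (mode u p v) (m + n - p%:Z) w)) ->
  P (mode u m (mode v n w) - mode v n (mode u m w)).
Proof.
move=> subP Puv.
have := jacobi_identity u v w (-1) (- m - 1) (- n - 1).
(* The product [Y(u,x1) Y(v,x2)] is free of x0, so the delta factor has x0-exponent -1; then x1 - x2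
   is raised to the power 0 and only its constant term survives. *)
rewrite (@mul_series1 _ _ _ _ _ (-1, 0, 0)).
  2: { move=> p q r pqr; case: eqP => [p1|_]; last by rewrite scaler0.
       have -> : p = -1 by lia.
       rewrite /delta_coef binom_coef_eq0 ?mulr0 ?scale0r // => r0 qr.
       apply: contraNT pqr => ?; apply/eqP; congr (_, _, _); lia. }
rewrite (@mul_series1 _ _ _ _ _ (-1, 0, 0)).
  2: { move=> p q r pqr; case: eqP => [p1|_]; last by rewrite scaler0.
       have -> : p = -1 by lia.
       rewrite /delta_coef binom_coef_eq0 ?mulr0 ?scale0r // => q0 qr.
       apply: contraNT pqr => ?; apply/eqP; congr (_, _, _); lia. }
rewrite /= /delta_coef !subrr !binom_coef0 !expr0z !mulr1 !scale1r !subr0.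
rewrite (_ : - (- m - 1) - 1 = m) 1?(_ : - (- n - 1) - 1 = n); try lia.
move=> ->; apply: mul_series_closed => // p q r d0.
case: eqP => [q1|_]; last exact: subspace0.
(* The right-hand delta is expanded in nonnegative powers of x0, so only the products [mode u p v]
   with [p >= 0] occur. *)
have [p0 pr] : 0 <= p /\ q + p = - r - 1.
  split; [rewrite leNgt|apply/eqP]; apply: contraNT d0.
    by rewrite negbK => p0; rewrite binom_coef_lt0 ?mulr0.
  by move=> p0; rewrite binom_coef_neq ?mulr0.
case: p p0 {d0} pr => // p _ pr.
have := Puv p; congr (P (mode (mode u _ v) _ w)); lia.
Qed.

(* The coefficient of x1^-1 in the Jacobi identity. *)
Lemma mode_associator P u v (l n : int) w : subspace P ->
  (forall r : nat, P (mode u (l - r%:Z) (mode v (n + r%:Z) w))) ->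
  (forall q : nat, P (mode v (n + l - q%:Z) (mode u q w))) ->
  P (mode (mode u l v) n w).
Proof.
move=> subP Puv Pvu.
have := jacobi_identity u v w (- l - 1) (-1) (- n - 1).
(* With x1-exponent -1, the coefficient of x0^p comes from (x1 - x0)^(p - 1); the binomial p - 1
   over p vanishes unless p = 0, so the right side is a single term. *)
rewrite [in RHS](@mul_series1 _ _ _ _ _ (0, -1, 0)).
  2: { move=> p q r pqr; case: eqP => [q1|_]; last by rewrite scaler0.
       have -> : q = -1 by lia.
       rewrite /delta_coef binom_coef_eq0 ?mulr0 ?scale0r // => p0 qr.
       apply: contraNT pqr => ?; apply/eqP; congr (_, _, _); lia. }
rewrite /= /delta_coef oppr0 sub0r binom_coef0 exp1rz mulr1 scale1r !subr0.
rewrite (_ : - (- l - 1) - 1 = l) 1?(_ : - (- n - 1) - 1 = n); try lia.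
move=> <-; apply: subspaceB => //; apply: mul_series_closed => // p q r d0.
  case: eqP => [p1|_]; last exact: subspace0.
  have [r0 pr] : 0 <= r /\ q + r = - p - 1.
    split; [rewrite leNgt|apply/eqP]; apply: contraNT d0.
      by rewrite negbK => r0; rewrite binom_coef_lt0 ?mulr0.
    by move=> r0; rewrite binom_coef_neq ?mulr0.
  case: r r0 {d0} pr => // r _ pr.
  have := Puv r; congr (P (mode u _ (mode v _ w))); lia.
case: eqP => [p1|_]; last exact: subspace0.
have [q0 pr] : 0 <= q /\ r + q = - p - 1.
  split; [rewrite leNgt|apply/eqP]; apply: contraNT d0.
    by rewrite negbK => q0; rewrite binom_coef_lt0 ?mulr0.
  by move=> q0; rewrite binom_coef_neq ?mulr0.
case: q q0 {d0} pr => // q _ pr.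
have := Pvu q; congr (P (mode v _ (mode u _ w))); lia.
Qed.
End Borcherds.

(** * The degree filtration and its compatibility with all modes *)

Section Filtration.
Variables (C : numFieldType) (V : vertexAlgebra C) (Un : nat -> set V).
Implicit Types (u v w x y : V).

Let E d : set V := lin_span (graded_words Un d).

Lemma graded_span_subspace d : subspace (E d).
Proof. exact: lin_span_subspace. Qed.

Lemma graded_span_le d e x : (d <= e)%N -> E d x -> E e x.
Proof.
move=> de; apply: lin_span_le => y [s [Us sd ->]]; exists s; split=> //.
exact: leq_trans de.
Qed.

Lemma graded_span_vac d : E d vac.
Proof. by apply: lin_span_gen; exists [::]; rewrite big_nil. Qed.

Lemma graded_span_mode m u (k : int) d x : (1 <= m)%N -> Un m u -> k < 0 ->
  E d x -> E (m + d) (mode u k x).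
Proof.
move=> m1 Uu k0.
apply: (lin_span_sub (subspace_preim (graded_span_subspace _) (mode_linear_end _ _))).
move=> {}x [s [Us sd ->]]; apply: lin_span_gen.
case: k k0 => // n _; exists ((m, u, n.+1) :: s); split.
- by rewrite /= m1 Us (mem_set Uu).
- by rewrite big_cons leq_add2l.
- by rewrite /= NegzE.
Qed.

(** Induction on the length of a graded word, extended to combinations because each [P d] is a
    subspace. *)
Lemma graded_span_ind (P : nat -> set V) : (forall d, subspace (P d)) ->
  (forall d, P d vac) ->
  (forall m u (k : int) d x, (1 <= m)%N -> Un m u -> k < 0 -> E d x -> P d x ->
    P (m + d)%N (mode u k x)) ->
  forall d x, E d x -> P d x.
Proof.
move=> subP P1 PS d; apply: lin_span_sub => // _ [s [Us sd ->]].
elim: s d Us sd => [//|[[m u] n] s IHs] d /= /andP[/and3P[m1 /set_mem Uu n1] Us].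
rewrite big_cons /= => sd.
(* The degree [d] is only an upper bound, so the tail receives all of the remaining budget
   [d - m]. *)
have md : (m <= d)%N := leq_trans (leq_addr _ _) sd.
have sdm : (\sum_(p <- s) p.1.1 <= d - m)%N by rewrite leq_subRL.
rewrite -(subnKC md); apply: PS => //; [lia| |exact: IHs].
by apply: lin_span_gen; exists s.
Qed.

Hypothesis hUn : forall (m n : nat) (u v : V) (i : nat),
  (1 <= m)%N -> (1 <= n)%N -> Un m u -> Un n v ->
  lin_span (graded_words Un (m + n - 1)%N) (mode u (i%:Z) v).

(** Strong induction on [a + b]. A generator acting on any [z] is treated first ([hU]), by commuting
    it through the letters of [z]; a general [x] is then built letter by letter with the
    associativity formula. *)
Lemma graded_span_closed a b x y k : E a x -> E b y -> E (a + b) (mode x k y).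
Proof.
have [D] := ubnP (a + b); elim: D a b x y k => // D IH a b x y k.
rewrite ltnS => abD.
have hU m u (k' : int) c z : (1 <= m)%N -> Un m u -> (m + c <= D)%N -> E c z ->
    E (m + c) (mode u k' z).
  move=> m1 Uu mcD Ez; have [k'0|] := ltP k' 0.
    exact: graded_span_mode.
  case: k' => // i _; move: mcD.
  pose P c z := (m + c <= D)%N -> E (m + c) (mode u i z).
  rewrite -/(P c z); move: c z Ez; apply: (@graded_span_ind P).
  - move=> c; apply: subspace_imply => _.
    exact: (subspace_preim (graded_span_subspace _) (mode_linear_end _ _)).
  - move=> c _; rewrite mode_creation //.
    exact: (subspace0 (graded_span_subspace _)).
  - move=> m' v k' c z m'1 Uv k'0 Ez Pz mcD.
    rewrite -[mode u i _](subrK (mode v k' (mode u i z))).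
    apply: (subspaceD (graded_span_subspace _)).
      apply: mode_commutator => [|p]; first exact: graded_span_subspace.
      (* The commutator consists of modes of [mode u p v], which has degree at most [m + m' - 1];
         this drop makes the outer induction hypothesis applicable. *)
      have Euv := hUn p m1 m'1 Uu Uv.
      apply: (@graded_span_le (m + m' - 1 + c)); [lia|apply: IH => //; lia].
    rewrite addnCA; apply: graded_span_mode => //; apply: Pz; lia.
(* The predicate quantifies over [b] and [y] because the associativity formula replaces [y] by
   [mode u q y], of degree [m + b], while the total degree stays the same. *)
pose P a x := forall b k y, (a + b <= D)%N -> E b y -> E (a + b) (mode x k y).
move=> Ex Ey; suff: P a x by apply.
move: a x Ex {b k y abD Ey}; apply: (@graded_span_ind P).
- move=> a; do 3 (apply: subspace_forall => ?); do 2 (apply: subspace_imply => ?).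
  exact: (subspace_preim (graded_span_subspace _) (mode_linear_state _ _)).
- move=> a b k y abD Ey; rewrite mode_vac; case: eqP => _.
    exact/graded_span_le/Ey/leq_addl.
  exact: (subspace0 (graded_span_subspace _)).
- move=> m u l a x m1 Uu l0 Ex Px b k y abD Ey.
  apply: mode_associator => [|r|q]; first exact: graded_span_subspace.
    rewrite -addnA; apply: graded_span_mode => //; first by lia.
    by apply: IH => //; lia.
  rewrite -addnA addnCA; apply: Px; first by lia.
  by apply: hU => //; lia.
Qed.

End Filtration.

(** * Exhaustion of [V] by the filtration *)

Section Exhaustion.
Variables (C : numFieldType) (V : vertexAlgebra C) (U : set V) (Un : nat -> set V).
Hypothesis hUn : forall (m n : nat) (u v : V) (i : nat),
  (1 <= m)%N -> (1 <= n)%N -> Un m u -> Un n v ->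
  lin_span (graded_words Un (m + n - 1)%N) (mode u (i%:Z) v).

(** Generating words use arbitrary modes of inhomogeneous vectors: each vector is split into its
    components, and [graded_span_closed] absorbs the nonnegative modes. *)
Lemma graded_span_exhaustive x : is_direct_sum U Un -> generates U ->
  exists d, lin_span (graded_words Un d) x.
Proof.
move=> [subUn decU _] genU.
pose E := [set x | exists d, lin_span (graded_words Un d) x]%classic.
have subE : subspace E.
  apply: subspaceI => [|a {}x y [d Ex] [e Ey]].
    by exists 0%N; exact: (subspace0 (graded_span_subspace _ _)).
  exists (maxn d e); apply: (subspaceL (graded_span_subspace _ _)).
    exact/graded_span_le/Ex/leq_maxl.
  exact/graded_span_le/Ey/leq_maxr.
have: [set: V]%classic x by [].
rewrite -genU; apply: (lin_span_sub subE) => _ [s [Us ->]].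
elim: s Us => [_|[u k] s IHs /= /andP[/set_mem/decU[N [f [Uf ->]]] {}/IHs [d Ed]]].
  by exists 0%N; exact: graded_span_vac.
apply: (subspace_sum_seq (subspace_preim subE (mode_linear_state k _))) => i.
(* The summand [i + 0] is the degree of [f i] seen as the one-letter word [mode (f i) (-1) vac]. *)
rewrite mem_index_iota => /andP[i1 _]; exists (i + 0 + d)%N.
apply: graded_span_closed => //; rewrite -[f i]mode_creationN1.
by apply: graded_span_mode (Uf _ i1) _ (graded_span_vac _ _).
Qed.

End Exhaustion.

(** * Existence of a homogeneous basis *)

Section Basis.
Variables (C : numFieldType) (V : lmodType C).
Implicit Types (U S : set V) (Un : nat -> set V).

Definition lin_free S : Prop :=
  forall (J : finType) (p : pred J) (f : J -> V) (c : J -> C),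
    {in p &, injective f} -> (forall j, p j -> S (f j)) ->
    \sum_(j | p j) c j *: f j = 0 -> forall j, p j -> c j = 0.

(** A finite family in the union of a chain already lies in one member of the chain. *)
Lemma lin_free_bigcup (F : set (set V)) : total_on F subset ->
  (forall S, F S -> lin_free S) -> lin_free (\bigcup_(S in F) S)%classic.
Proof.
move=> Ftot Ffree J p f c finj Ff sum0 j pj.
(* The index [j] provides a member of the chain, which could otherwise be empty. *)
have [S0 FS0 _] := Ff j pj.
suff [S FS Sf] : exists2 S, F S & forall j, j \in enum p -> S (f j).
  by apply: (Ffree S FS J p f c) => // i pi; apply: Sf; rewrite mem_enum.
have: all p (enum p) by apply/allP => i; rewrite mem_enum.
elim: (enum p) => [_|i s IHs /= /andP[/Ff[T FT Ti] {}/IHs [S FS Ss]]].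
  by exists S0.
have [ST|TS] := Ftot S T FS FT; [exists T|exists S] => // i'; rewrite inE => /predU1P[->|] //.
- by move=> /Ss/ST.
- exact: TS.
- exact: Ss.
Qed.

(** A nonzero coefficient at [x] could be inverted to put [x] in the span of [S]. *)
Lemma lin_free_setU1 S x : lin_free S -> ~ lin_span S x -> lin_free (S `|` [set x])%classic.
Proof.
move=> Sfree Sx J p f c finj Sf sum0.
have [[i pi fi]|noi] := pselect (exists2 i, p i & f i = x).
  move: sum0; rewrite (bigD1 i) //= fi => sum0.
  pose q j := p j && (j != i).
  have Sfq j : q j -> S (f j).
    move=> /andP[pj ji]; case: (Sf j pj) => //= fj.
    by case/eqP: ji; apply: finj; rewrite // fj fi.
  have ci : c i = 0.
    apply/eqP/negPn/negP => ci; apply: Sx.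
    rewrite -[x](scalerK ci).
    have -> : c i *: x = - \sum_(j | q j) c j *: f j by apply/eqP; rewrite -addr_eq0; apply/eqP.
    apply: (subspaceZ (lin_span_subspace _)); apply: (subspaceN (lin_span_subspace _)).
    apply: (subspace_sum (lin_span_subspace _)) => j /Sfq Sj.
    exact/(subspaceZ (lin_span_subspace _))/lin_span_gen.
  move: sum0; rewrite ci scale0r add0r => sum0 j pj.
  have [->//|ji] := eqVneq j i.
  apply: (Sfree J q f c) => //; last by rewrite /q pj.
  by move=> j1 j2 /andP[pj1 _] /andP[pj2 _]; apply: finj.
apply: (Sfree J p f c) => // j pj; case: (Sf j pj) => //= fj.
by case: noi; exists j.
Qed.

(** By Zorn's lemma there is a maximal free subset of [U]; a vector outside its span would enlarge
    it. *)
Lemma lin_free_basis U : exists S,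
  [/\ (S `<=` U)%classic, lin_free S & (U `<=` lin_span S)%classic].
Proof.
pose P := [set S | (S `<=` U)%classic /\ lin_free S]%classic.
have [F FP Ftot|S [[SU Sfree] Smax]] := @Zorn_bigcup V P.
  split; last by apply: lin_free_bigcup => // S /FP[].
  by move=> x [S /FP[SU _] /SU].
exists S; split=> // x Ux; apply: contrapT => Sx.
apply: (Smax (S `|` [set x])%classic); last first.
  by split; [move=> y [/SU|->] | apply: lin_free_setU1].
split; first by move=> y; left.
by move=> /(_ x (or_intror erefl)) /lin_span_gen.
Qed.

Lemma homogeneous_basis U Un : is_direct_sum U Un ->
  exists (I : choiceType) (b : I -> V) (deg : I -> nat),
    [/\ is_basis b U,
        forall i, (1 <= deg i)%N,
        forall i, Un (deg i) (b i)
      & forall m, (1 <= m)%N ->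
          (Un m `<=` lin_span [set b i | i in [set i | deg i = m]])%classic].
Proof.
move=> [subUn decU dirU].
have [S HS] := choice (fun n => lin_free_basis (Un n)).
have SU n : (S n `<=` Un n)%classic by have [] := HS n.
have Sfree n : lin_free (S n) by have [] := HS n.
have SspanU n : (Un n `<=` lin_span (S n))%classic by have [] := HS n.
(* An index is a basis vector tagged with its degree. The boolean reflection makes [I] a subtype
   with decidable equality, as permutations of words require. *)
pose I := {p : nat * V | `[< (1 <= p.1)%N /\ S p.1 p.2 >]}.
pose b (i : I) := (val i).2; pose deg (i : I) := (val i).1.
have degb (i : I) : (1 <= deg i)%N /\ S (deg i) (b i) by apply/asboolP/(valP i).
have span_b m : (1 <= m)%N ->
    (Un m `<=` lin_span [set b i | i in [set i | deg i = m]])%classic.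
  move=> m1 u /SspanU; apply: lin_span_le => x Sx.
  have mx : `[< (1 <= (m, x).1)%N /\ S (m, x).1 (m, x).2 >] by apply/asboolP.
  by exists (exist _ (m, x) mx).
have Unb i : Un (deg i) (b i) by apply: SU; have [] := degb i.
exists I, b, deg; split=> //; last by move=> i; have [] := degb i.
split.
- move=> i; apply/decU; exists (deg i).+1, (fun n => if n == deg i then b i else 0).
  have [di _] := degb i; split.
    move=> n n1; case: eqP => [->//|_]; exact: (subspace0 (subUn n n1)).
  rewrite big_nat_recr //= eqxx big_nat big1 ?add0r // => n /andP[_ nd].
  by rewrite ltn_eqF.
- move=> k f c finj sum0 j.
  (* A vanishing combination is grouped by degree: directness kills each component [g n], and
     freeness of [S n] then kills the coefficients. *)
  pose g n := \sum_(j | deg (f j) == n) c j *: b (f j).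
  have Ug n : (1 <= n)%N -> Un n (g n).
    move=> n1; apply: (subspace_sum (subUn n n1)) => i /eqP <-.
    by apply: subspaceZ => //; apply: subUn; have [] := degb (f i).
  pose N := (\max_(j < k) deg (f j)).+1.
  have dN i : (1 <= deg (f i) < N)%N.
    by rewrite ltnS; have [-> _] := degb (f i); apply: leq_bigmax.
  have g0 : g (deg (f j)) = 0.
    apply: (dirU N) => //; rewrite -[RHS]sum0 (exchange_big_dep xpredT) //=.
    apply: eq_bigr => i _; under eq_bigl do rewrite eq_sym.
    by rewrite big_nat1_eq dN.
  apply: (Sfree (deg (f j)) 'I_k (fun i => deg (f i) == deg (f j)) (b \o f) c) => //.
    move=> i i' /eqP di /eqP di' bi; apply/finj/val_inj.
    rewrite [LHS]surjective_pairing [RHS]surjective_pairing.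
    by congr (_, _) => //; apply: etrans di (esym di').
  by move=> i /eqP <- /=; have [] := degb (f i).
- move=> u /decU[N [f [Uf ->]]].
  apply: (subspace_sum_seq (lin_span_subspace _)) => n.
  rewrite mem_index_iota => /andP[n1 _].
  by apply: lin_span_le (span_b n n1 _ (Uf n n1)) => _ [i _ <-]; exists i.
Qed.

End Basis.

(** * Reordering words modulo lower degree *)

Section PBW.
Variables (C : numFieldType) (V : vertexAlgebra C) (Un : nat -> set V).
Variables (I : eqType) (b : I -> V) (deg : I -> nat).
Hypothesis hUn : forall (m n : nat) (u v : V) (i : nat),
  (1 <= m)%N -> (1 <= n)%N -> Un m u -> Un n v ->
  lin_span (graded_words Un (m + n - 1)%N) (mode u (i%:Z) v).
Hypothesis deg_gt0 : forall i, (1 <= deg i)%N.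
Hypothesis Un_b : forall i, Un (deg i) (b i).

Implicit Types (p q : I * nat) (s t : seq (I * nat)).

Let E d : set V := lin_span (graded_words Un d).
Let op p : V -> V := mode (b p.1) (- p.2%:Z).
Let word s : V := apply_ops [seq op p | p <- s].
Let wdeg s := (\sum_(p <- s) deg p.1)%N.
Let wneg s := all (fun p => 1 <= p.2)%N s.

Lemma op_graded p d x : (1 <= p.2)%N -> E d x -> E (deg p.1 + d) (op p x).
Proof. by move=> p1; apply: graded_span_mode => //; lia. Qed.

Lemma word_graded s : wneg s -> E (wdeg s) (word s).
Proof.
elim: s => [_|p s IHs /= /andP[p1 /IHs Es]]; first exact: graded_span_vac.
by rewrite /wdeg big_cons; apply: op_graded.
Qed.

Lemma opB p x y : op p (x - y) = op p x - op p y.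
Proof. by rewrite addrC -scaleN1r [LHS]mode_linear_end scaleN1r addrC. Qed.

Lemma op_commutator p q d x : E d x ->
  E (deg p.1 + deg q.1 + d - 1) (op p (op q x) - op q (op p x)).
Proof.
move=> Ex; apply: mode_commutator => [|i]; first exact: graded_span_subspace.
have [p1 q1] := (deg_gt0 p.1, deg_gt0 q.1).
have Epq := hUn i p1 q1 (Un_b p.1) (Un_b q.1).
rewrite (_ : _ + _ + _ - 1 = deg p.1 + deg q.1 - 1 + d)%N; last by lia.
exact: graded_span_closed.
Qed.

(** Moving [p] one letter to the right costs a commutator, which [op_commutator] places one degree
    lower; the costs add up along [s]. *)
Lemma word_move p s t : wneg (p :: s ++ t) ->
  E (wdeg (p :: s ++ t) - 1) (word (p :: s ++ t) - word (s ++ p :: t)).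
Proof.
elim: s => [_|q s IHs /= /and3P[p1 q1 st1]].
  by rewrite subrr; apply: (subspace0 (graded_span_subspace _ _)).
have := IHs; rewrite /= p1 st1 => /(_ isT) /(op_graded q1).
rewrite /wdeg !big_cons opB => Es.
rewrite -[word (p :: _)](subrK (op q (word (p :: s ++ t)))) -addrA.
apply: (subspaceD (graded_span_subspace _ _)).
  apply: graded_span_le (op_commutator _ _ (word_graded st1)).
  by rewrite /wdeg; lia.
apply: graded_span_le Es.
by have := deg_gt0 p.1; lia.
Qed.

(** Induction on [s]: its head [p] occurs in [t] as [t1 ++ p :: t2]; the tail is permuted to
    [t1 ++ t2] under [p], and then [word_move] puts [p] in place. *)
Lemma word_perm s t : wneg s -> perm_eq s t -> E (wdeg s - 1) (word s - word t).
Proof.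
have E0 d : E d 0 := subspace0 (graded_span_subspace _ _).
elim: s t => [|p s IHs] t ns; first by rewrite perm_sym => /perm_nilP ->; rewrite subrr.
move=> st; have pt : p \in t by rewrite -(perm_mem st) mem_head.
move: pt st; case/splitPr: t / => t1 t2 st.
have {}st : perm_eq s (t1 ++ t2).
  by rewrite -(perm_cons p) (perm_trans st) // perm_catC /= perm_cons perm_catC.
have nt : wneg (p :: t1 ++ t2) by rewrite /wneg -(perm_all _ (_ : perm_eq (p :: s) _)) // perm_cons.
have ts : wdeg (p :: t1 ++ t2) = wdeg (p :: s).
  by apply/esym/perm_big; rewrite perm_cons.
rewrite -[word (p :: s)](subrK (word (p :: t1 ++ t2))) -addrA.
apply: (subspaceD (graded_span_subspace _ _)); last by rewrite -ts; apply: word_move.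
have /andP[p1 ns'] : wneg (p :: s) := ns.
have -> : word (p :: s) - word (p :: t1 ++ t2) = op p (word s - word (t1 ++ t2)).
  by rewrite opB.
(* The empty tail is separate because [wdeg [::] - 1] truncates to 0 and would lose the degree drop;
   there the difference is exactly 0. *)
case: s IHs st ns' {ns nt ts} => [_|q s IHs st ns'].
  by rewrite perm_sym => /perm_nilP -> _; rewrite opB subrr; apply: E0.
apply: graded_span_le (op_graded p1 (IHs _ ns' st)).
by rewrite /wdeg !big_cons; have := deg_gt0 q.1; lia.
Qed.

Hypothesis Un_span : forall m, (1 <= m)%N ->
  (Un m `<=` lin_span [set b i | i in [set i | deg i = m]])%classic.

(** Strong induction on the degree, with an inner induction on words. By linearity the new letter is
    a basis vector and the tail a sorted word; sorting the result leaves an error of lower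
    degree. *)
Lemma pbw_span (ge : rel (V -> V)) d x :
  {in [pred p | (1 <= p.2)%N] &, total (relpre op ge)} -> E d x ->
  lin_span [set x | exists s, [/\ wneg s, sorted ge [seq op p | p <- s]
    & x = word s]]%classic x.
Proof.
move=> ge_total.
(* [F] keeps the degree bound, so that prefixing a letter to a sorted word stays within the range of
   the outer induction. *)
pose F d := lin_span [set x | exists s, [/\ wneg s, sorted ge [seq op p | p <- s],
  (wdeg s <= d)%N & x = word s]]%classic.
have Fle d1 d2 y : (d1 <= d2)%N -> F d1 y -> F d2 y.
  move=> d12; apply: lin_span_le => _ [s [ns ss sd ->]]; exists s; split=> //.
  exact: leq_trans d12.
have subF n : subspace (F n) := lin_span_subspace _.
suff EF : E d x -> F d x.
  by move=> /EF; apply: lin_span_le => _ [s [ns ss _ ->]]; exists s.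
have [D] := ubnP d; elim: D d x => // D IH d x; rewrite ltnS.
pose P d x := (d <= D)%N -> F d x.
move=> dD Ex; move: dD; rewrite -/(P d x); move: d x Ex.
apply: graded_span_ind => [d|d _|m u k d x m1 Uu k0 Ex Px mdD].
- exact: subspace_imply.
- by apply: lin_span_gen; exists [::]; rewrite /wdeg big_nil.
have {Px} Fx : F d x by apply: Px; lia.
apply: (lin_span_sub (subspace_preim (subF _) (mode_linear_state k x)) _ (Un_span m1 Uu)).
move=> _ [i im <-] /=.
apply: (lin_span_sub (subspace_preim (subF _) (mode_linear_end (b i) k)) _ Fx).
move=> _ [s [ns _ sd ->]] /=; case: k k0 => // n _.
pose p := (i, n.+1); rewrite NegzE -[mode _ _ _]/(word (p :: s)).
have nps : wneg (p :: s) by [].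
have psd : (wdeg (p :: s) <= m + d)%N by rewrite /wdeg big_cons im leq_add2l.
set t := sort (relpre op ge) (p :: s).
have st : perm_eq (p :: s) t by rewrite perm_sym perm_sort.
rewrite -[word _](subrK (word t)); apply: (subspaceD (subF _)).
  have Est := word_perm nps st.
  apply: (Fle (wdeg (p :: s) - 1)%N); first by lia.
  (* Since [deg i >= 1], the truncated [wdeg (p :: s) - 1] is strictly below [D]. *)
  by apply: IH => //; have := deg_gt0 i; rewrite /wdeg big_cons /= in psd *; lia.
apply: lin_span_gen; exists t; split=> //.
- by rewrite /wneg -(perm_all _ st).
- rewrite sorted_map; exact: sort_sorted_in ge_total _ nps.
- by rewrite /wdeg -(perm_big _ st).
Qed.

End PBW.

Theorem theorem4p8 (R : realType) (V : vertexAlgebra R[i]%C) (U : set V)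
    (subU : subspace U) (genU : generates U) (Un : nat -> set V)
    (decU : is_direct_sum U Un)
    (hUn : forall (m n : nat) (u v : V) (i : nat),
        (1 <= m)%N -> (1 <= n)%N -> Un m u -> Un n v ->
        lin_span (graded_words Un (m + n - 1)%N) (mode u (i%:Z) v)) :
  PBW_spanning U.
Proof.
(* A homogeneous basis is chosen before any order is given, so that every letter carries a
   degree. *)
have [I [b [deg [basis_b deg_gt0 Un_b Un_span]]]] := homogeneous_basis decU.
exists I, b; split=> // op ops ge _ _ _ ge_total.
apply/seteqP; split=> // x _.
have [d Ex] := graded_span_exhaustive hUn x decU genU.
apply: (pbw_span hUn deg_gt0 Un_b Un_span _ Ex) => p q p1 q1.
by apply: ge_total; apply/mem_set; [exists p|exists q].
Qed.
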